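(* Let $G$ be a finite, connected, undirected multigraph without loops, let $x\neq y$ be vertices, and let $k_{xy}$ be an integer. Let $G_1$ be the multigraph obtained from $G$ by deleting $k_{xy}$ of the edges between $x$ and $y$ if $k_{xy}\ge 0$ (assuming $G$ has at least $k_{xy}$ such edges), or by adding $|k_{xy}|$ edges between $x$ and $y$ if $k_{xy}<0$; assume $G_1$ is connected. Let $S$ be the subgroup of $\mathrm{Jac}(G)$ generated by $[\delta_{xy}]$ and $S_1$ the subgroup of $\mathrm{Jac}(G_1)$ generated by $[\delta_{xy}]$. Then $$[\mathrm{Jac}(G):S]\ \Big|\ \gcd(|\mathrm{Jac}(G)|,|\mathrm{Jac}(G_1)|)\quad\text{and}\quad [\mathrm{Jac}(G_1):S_1]\ \Big|\ \gcd(|\mathrm{Jac}(G)|,|\mathrm{Jac}(G_1)|).$$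
   Context: For a finite connected loopless multigraph $H$ with vertex set $V(H)$: a divisor is an element of $\mathbb{Z}^{V(H)}$; its degree is the sum of its values; $\mathrm{Div}^0(H)$ is the group of degree-zero divisors. The Laplacian is $L=\Delta-A$, where $\Delta$ is the diagonal matrix of vertex valencies and $A_{vw}$ is the number of edges between $v$ and $w$. Principal divisors are those of the form $L\sigma$ with $\sigma\in\mathbb{Z}^{V(H)}$, and $\mathrm{Jac}(H)=\mathrm{Div}^0(H)/\{L\sigma\}$, a finite abelian group whose order equals the number of spanning trees of $H$. For vertices $x\neq y$, $\delta_{xy}$ is the divisor with value $-1$ at $x$, $1$ at $y$ and $0$ elsewhere, and $[\delta_{xy}]$ is its class in the Jacobian. *)

(* Defs.v *)
From HB Require Import structures.
From mathcomp Require Import all_boot all_order all_algebra all_fingroup.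
From mathcomp Require Import boolp.

Set Implicit Arguments.
Unset Strict Implicit.
Unset Printing Implicit Defensive.

Import Order.TTheory GRing.Theory Num.Theory.

Local Open Scope ring_scope.
Local Open Scope quotient_scope.

(* An undirected multigraph without loops on the vertex type V, given by its
   edge multiplicities: mult G u v is the number of edges between u and v. *)
Record multigraph (V : finType) := Multigraph {
  mult :> V -> V -> nat;
  multC : forall u v, mult u v = mult v u;
  mult_loopless : forall v, mult v v = 0%N }.

Section Jacobian.

Variable V : finType.
Implicit Types (G : multigraph V) (D s : {ffun V -> int}).

Definition adjacent G : rel V := [rel u v | 0 < G u v]%N.

Definition connected_graph G : Prop := forall u v : V, connect (adjacent G) u v.

Definition valency G (v : V) : nat := (\sum_w G v w)%N.

Definition laplacian G (v w : V) : int :=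
  (if v == w then (valency G v)%:Z else 0) - (G v w)%:Z.

Definition lap_mul G s : {ffun V -> int} :=
  [ffun v => \sum_w laplacian G v w * s w].

Definition deg D : int := \sum_v D v.

Definition deg0 : {pred {ffun V -> int}} := [pred D | deg D == 0].

Fact deg0_zmod_closed : zmod_closed deg0.
Proof.
split=> [|D E]; rewrite !inE /deg; first by rewrite big1 // => v; rewrite ffunE.
move=> /eqP D0 /eqP E0.
under eq_bigr do rewrite !ffunE.
by rewrite sumrB D0 E0 subrr.
Qed.
HB.instance Definition _ :=
  GRing.isZmodClosed.Build {ffun V -> int} deg0 deg0_zmod_closed.

Record Div0 : predArgType :=
  MkDiv0 { div0_val :> {ffun V -> int}; _ : div0_val \in deg0 }.
HB.instance Definition _ := [isSub for div0_val].
HB.instance Definition _ := [Choice of Div0 by <:].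
HB.instance Definition _ := [SubChoice_isSubZmodule of Div0 by <:].

Definition delta_val (x y : V) : {ffun V -> int} :=
  [ffun v => (v == y)%:R - (v == x)%:R].

Fact delta_val_deg0 x y : delta_val x y \in deg0.
Proof.
rewrite inE /deg; under eq_bigr do rewrite ffunE.
by rewrite sumrB -!natr_sum -!big_mkcond !sum1_card !card1 subrr.
Qed.

Definition delta (x y : V) : Div0 := MkDiv0 (delta_val_deg0 x y).

(* The subgroup of divisors of the form L s; membership is made boolean
   classically, as required by the quotient construction. *)
Definition principal G : {pred Div0} :=
  [pred D : Div0 | `[< exists s, div0_val D = lap_mul G s >]].

Lemma lap_mulB G s t : lap_mul G (s - t) = lap_mul G s - lap_mul G t.
Proof.
apply/ffunP => v; rewrite !ffunE -sumrB; apply: eq_bigr => w _.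
by rewrite !ffunE mulrBr.
Qed.

Fact principal_zmod_closed G : zmod_closed (principal G).
Proof.
split=> [|D E]; rewrite !inE.
  apply/asboolP; exists 0; apply/ffunP => v; rewrite !ffunE.
  by rewrite big1 // => w _; rewrite ffunE mulr0.
move=> /asboolP[s Ds] /asboolP[t Et]; apply/asboolP; exists (s - t).
by rewrite lap_mulB -Ds -Et.
Qed.
HB.instance Definition _ G :=
  GRing.isZmodClosed.Build Div0 (principal G) (principal_zmod_closed G).

(* The quotient only depends on G; the connectedness proof is what makes it
   finite, hence is recorded in the type so that the finite group structure
   below can be inferred. As for any finZmodType, #|_ : _| and <[_]> refer to
   the additive group. *)
Definition Jac G (cG : connected_graph G) : predArgType :=
  Quotient.quot (principal G : zmodClosed Div0).

Section Finiteness.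

Variables (G : multigraph V) (cG : connected_graph G).

HB.instance Definition _ := Choice.on (Jac cG).
HB.instance Definition _ := GRing.Zmodule.on (Jac cG).

Definition jac_class (D : Div0) : Jac cG :=
  \pi_(Quotient.quot (principal G : zmodClosed Div0)) D.

Lemma jac_classE (D E : Div0) :
  (jac_class D == jac_class E) = (D - E \in principal G).
Proof. by rewrite (Quotient.idealrBE (principal G : zmodClosed Div0)). Qed.

Lemma lap_mulE s v : lap_mul G s v = \sum_w (G v w)%:Z * (s v - s w).
Proof.
rewrite ffunE /laplacian.
under eq_bigr do rewrite mulrBl.
under [RHS]eq_bigr do rewrite mulrBr.
rewrite !sumrB; congr (_ - _).
rewrite (bigD1 v) //= eqxx big1 => [|w /negPf]; last first.
  by rewrite eq_sym => ->; rewrite mul0r.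
by rewrite addr0 -mulr_suml /valency (big_morph Posz PoszD (erefl _)).
Qed.

Lemma deg_lap s : deg (lap_mul G s) = 0.
Proof.
rewrite /deg; under eq_bigr do rewrite lap_mulE.
set S := (LHS); suff: S = - S by move/esym/eqP; rewrite eqNr => /eqP.
rewrite {1}/S exchange_big /S -sumrN; apply: eq_bigr => u _.
rewrite -sumrN; apply: eq_bigr => w _.
by rewrite multC -mulrN opprB.
Qed.

Lemma lap_ker s : lap_mul G s = 0 -> forall u v, s u = s v.
Proof.
move=> s0 u v.
pose m := [arg max_(w > u) s w]%O.
have sm w : s w <= s m by rewrite /m; case: arg_maxP => // i _; apply.
suff E w : s w = s m by rewrite !E.
have step a b : adjacent G a b -> s a = s m -> s b = s m.
  move=> ab sa; have := congr1 (fun f : {ffun V -> int} => f a) s0.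
  rewrite lap_mulE ffunE => /eqP; rewrite psumr_eq0; last first.
    by move=> c _; rewrite mulr_ge0 // subr_ge0 sa.
  move/allP/(_ b (mem_index_enum _)); rewrite mulf_eq0 subr_eq0 sa.
  by case/orP => /eqP // [Gab]; move: ab; rewrite /adjacent /= Gab.
have gen p : forall a, s a = s m -> path (adjacent G) a p -> s (last a p) = s m.
  elim: p => //= b p IHp a sa /andP[ab pb].
  exact: IHp (step _ _ ab sa) pb.
by have /connectP[p mp ->] := cG m w; exact: gen mp.
Qed.

Lemma jac_exponent :
  exists N : nat, (0 < N)%N /\ forall D : Div0, D *+ N \in principal G.
Proof.
pose n := #|V|.
have [n0|n_gt0] := posnP n.
  exists 1%N; split=> // D; rewrite mulr1n inE; apply/asboolP; exists 0.
  by apply/ffunP => v; move: (card0_eq n0 v); rewrite inE.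
pose e (v : V) : 'I_n := enum_rank v.
pose M : 'M[int]_n := \matrix_(i, j) (laplacian G (enum_val i) (enum_val j) + 1).
pose fn (c : 'cV[int]_n) : {ffun V -> int} := [ffun v => c (e v) 0].
have ME c v : (M *m c) (e v) 0 = lap_mul G (fn c) v + deg (fn c).
  rewrite mxE [in RHS]ffunE /deg -big_split /= (reindex e) /=; last first.
    by exists enum_val => i _; rewrite /e ?enum_rankK ?enum_valK.
  by apply: eq_bigr => w _; rewrite !mxE !enum_rankK ffunE mulrDl mul1r.
have degM c : \sum_v (M *m c) (e v) 0 = deg (fn c) *+ n.
  under eq_bigr do rewrite ME.
  by rewrite big_split /= -[X in X + _]/(deg _) deg_lap add0r sumr_const.
have ker (c : 'cV[int]_n) : M *m c = 0 -> c = 0.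
  move=> Mc0; have d0 : deg (fn c) = 0.
    have := degM c; rewrite Mc0; under eq_bigr do rewrite mxE.
    by rewrite big1 // => /esym/eqP; rewrite mulrn_eq0 (gtn_eqF n_gt0) => /eqP.
  have l0 : lap_mul G (fn c) = 0.
    by apply/ffunP => v; have := ME c v; rewrite Mc0 mxE d0 addr0 => <-; rewrite ffunE.
  have cst := lap_ker l0.
  apply/matrixP => i j; rewrite ord1 mxE.
  have := d0; rewrite /deg.
  under eq_bigr do rewrite (cst _ (enum_val i)).
  rewrite sumr_const => /eqP; rewrite mulrn_eq0 (gtn_eqF n_gt0) ffunE /= => /eqP.
  by rewrite /e enum_valK.
have detM : \det M != 0.
  rewrite -det_tr; apply/det0P => -[v v0 vM]; case/negP: v0.
  have: v^T = 0 by apply: ker; rewrite -[M]trmxK -trmx_mul vM trmx0.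
  by move/(congr1 trmx); rewrite trmxK trmx0 => ->.
have prin_det (D : Div0) : exists s, div0_val (D *~ \det M) = lap_mul G s.
  pose c : 'cV[int]_n := \adj M *m \col_i D (enum_val i).
  have Mc v : (M *m c) (e v) 0 = \det M * D v.
    by rewrite mulmxA mul_mx_adj mul_scalar_mx !mxE enum_rankK.
  have d0 : deg (fn c) = 0.
    have := degM c; under eq_bigr do rewrite Mc.
    have /eqP degD : deg D == 0 by case: (D).
    rewrite -mulr_sumr -[X in _ * X]/(deg D) degD mulr0 => /esym/eqP.
    by rewrite mulrn_eq0 (gtn_eqF n_gt0) => /eqP.
  exists (fn c); apply/ffunP => v.
  have := ME c v; rewrite d0 addr0 Mc => <-.
  have -> : div0_val (D *~ \det M) = div0_val D *~ \det M by exact: (raddfMz val).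
  by rewrite ffunMzE mulrzz mulrC.
have prinM (D : Div0) : D *~ \det M \in principal G.
  by rewrite inE; apply/asboolP; exact: prin_det.
exists `|\det M|%N; split; first by rewrite absz_gt0.
move=> D; move: (prinM D); case: (\det M) => m //.
by rewrite -[D *~ _]/(- (D *+ m.+1)) rpredN.
Qed.

Lemma jac_finite : exists (T : finType) (f : Jac cG -> T), injective f.
Proof.
have [[|N] [// _ N_prin]] := jac_exponent.
pose red (D : Div0) : {ffun V -> 'I_N.+1} :=
  [ffun v => inord `|(D v %% N.+1%:Z)%Z|].
exists {ffun V -> 'I_N.+1}, (fun c => red (generic_quotient.repr c)) => c d red_cd.
rewrite -[c]reprK -[d]reprK; apply/eqP; rewrite [_ == _]jac_classE.
set D := generic_quotient.repr c in red_cd *; set E := generic_quotient.repr d in red_cd *.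
have dvd v : (N.+1%:Z %| D v - E v)%Z.
  rewrite -eqz_mod_dvd; move/ffunP/(_ v): red_cd; rewrite !ffunE.
  have bnd (z : int) : (`|(z %% N.+1%:Z)%Z| < N.+1)%N.
    by rewrite -ltz_nat gez0_abs ?modz_ge0 // ltz_pmod.
  move/(congr1 val); rewrite /= !inordK // => /(congr1 Posz).
  by rewrite !gez0_abs ?modz_ge0 // => ->.
pose F : {ffun V -> int} := [ffun v => ((D v - E v) %/ N.+1%:Z)%Z].
have DE : F *+ N.+1 = div0_val D - div0_val E.
  apply/ffunP => v; rewrite ffunMnE !ffunE.
  by rewrite -mulr_natr natz divzK.
have F0 : F \in deg0.
  rewrite inE; suff: deg F *+ N.+1 == 0 by rewrite mulrn_eq0.
  have -> : deg F *+ N.+1 = deg (F *+ N.+1).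
    by rewrite /deg -sumrMnl; apply: eq_bigr => v _; rewrite ffunMnE.
  rewrite DE; have := valP (D - E); rewrite inE.
  by rewrite [val _](raddfB val).
suff -> : D - E = MkDiv0 F0 *+ N.+1 by exact: N_prin.
by apply: val_inj; rewrite [LHS](raddfB val) [RHS](raddfMn val) /= DE.
Qed.

Fact jac_pcancel : exists (T : finType) (f : Jac cG -> T) (g : T -> option (Jac cG)),
  pcancel f g.
Proof.
have [T [f f_inj]] := jac_finite.
exists T, f, (fun t => if pselect (exists c, f c = t) is left e
                       then Some (projT1 (cid e)) else None) => c.
case: pselect => [e|[]]; last by exists c.
by congr Some; case: (cid e) => d /= /f_inj.
Qed.

Let jac_finT := projT1 (cid jac_pcancel).
Let jac_enc := projT1 (cid (projT2 (cid jac_pcancel))).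
Let jac_decP := cid (projT2 (cid (projT2 (cid jac_pcancel)))).

HB.instance Definition _ : isCountable (Jac cG) :=
  PCanIsCountable (projT2 jac_decP).
HB.instance Definition _ : isFinite (Jac cG) := PCanIsFinite (projT2 jac_decP).
HB.instance Definition _ := [finGroupMixin of Jac cG for +%R].

End Finiteness.
End Jacobian.

Section ChangeEdges.

Variables (V : finType) (G : multigraph V) (x y : V) (k : int).

Definition change_mult (u v : V) : nat :=
  if (u != v) && ([set u; v] == [set x; y]) then
    match k with
    | Posz m => (G u v - m)%N
    | Negz m => (G u v + m.+1)%N
    end
  else G u v.

Fact change_multC u v : change_mult u v = change_mult v u.
Proof. by rewrite /change_mult eq_sym setUC multC. Qed.

Fact change_mult_loopless v : change_mult v v = 0%N.
Proof. by rewrite /change_mult eqxx mult_loopless. Qed.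

(* Deletes k edges between x and y if k >= 0, adds |k| such edges if k < 0.
   Deletion truncates at zero, so it is meant for k <= G x y; the test u != v
   only matters when x = y, where it keeps the graph loopless. *)
Definition change_edges : multigraph V :=
  Multigraph change_multC change_mult_loopless.

End ChangeEdges.

(* Main.v *)
(* For every s, the vectors L_G s and L_G1 s differ by an integer multiple of
   delta_xy.  Hence a degree-zero divisor is congruent to a multiple of
   delta_xy modulo the principal divisors of G iff it is so for G1, both
   quotients Jac(G)/S and Jac(G1)/S1 are Div^0 modulo the same subgroup, and
   the two indices coincide; the claim is then Lagrange's theorem. *)
Require Import Defs.
From mathcomp Require Import all_boot all_order all_algebra all_fingroup.
From mathcomp Require Import boolp ring.

Set Implicit Arguments.
Unset Strict Implicit.
Unset Printing Implicit Defensive.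

Import Order.TTheory GRing.Theory Num.Theory.

Local Open Scope ring_scope.

(** The map [h] sends a coset of [S] to the coset of [T] through the [f]-image of its chosen
    representative; the hypothesis makes it injective. No morphism property is asked of [f], so [f]
    may be built from arbitrary representatives. *)
Lemma leq_index_preim (aT bT : finGroupType) (S : {group aT}) (T : {group bT})
    (f : aT -> bT) :
    (forall a b, f a * (f b)^-1 \in T -> a * b^-1 \in S)%g ->
  (#|[set: aT] : S|%g <= #|[set: bT] : T|%g)%N.
Proof.
move=> fTS; pose h C := (T :* f (repr C))%g.
have h_inj : {in rcosets S [set: aT] &, injective h}.
  move=> _ _ /rcosetsP[a _ ->] /rcosetsP[b _ ->] /rcoset_eqP.
  rewrite mem_rcoset => /fTS; rewrite -mem_rcoset => /rcoset_eqP.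
  by rewrite !rcoset_repr.
rewrite [leqLHS]/indexg -(card_in_imset h_inj); apply: subset_leq_card.
apply/subsetP => _ /imsetP[C _ ->].
by rewrite mem_rcosets mulSGid ?subsetT // inE.
Qed.

Section ChangeEdges.

Variables (V : finType) (x y : V).
Implicit Types (G : multigraph V) (k : int) (D : Div0 V) (s : {ffun V -> int}).

(** The indicators are the two orientations of the edge xy, exclusive because [x != y]. The bound on
    [k] keeps the truncated subtraction exact. *)
Lemma change_edgesE G k u v : x != y -> (0 <= k -> k <= (G x y)%:Z) ->
  (change_edges G x y k u v)%:Z =
    (G u v)%:Z - k * ((u == x) && (v == y))%:R - k * ((u == y) && (v == x))%:R.
Proof.
move=> nxy le_k; rewrite /= /change_mult.
have -> : (u != v) && ([set u; v] == [set x; y]) =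
          ((u == x) && (v == y)) || ((u == y) && (v == x)).
  apply/idP/idP => [/andP[nuv /eqP/setP E]|].
    have := E u; have := E v; rewrite !inE !eqxx ?orbT /= => /esym vE /esym uE.
    case/orP: uE nuv => /eqP->; case/orP: vE => /eqP->; rewrite ?eqxx ?orbT //.
  case/orP => /andP[/eqP-> /eqP->]; first by rewrite nxy eqxx.
  by rewrite eq_sym nxy setUC eqxx.
(* [Negz m] is -(m+1), so adding [m.+1] edges is again subtracting [k]. *)
have shift a : (0 <= k -> k <= a%:Z) ->
    (match k with Posz m => (a - m)%N | Negz m => (a + m.+1)%N end)%:Z = a%:Z - k.
  case: k {le_k} => m le_ma; last by rewrite NegzE opprK PoszD.
  by rewrite subzn // -lez_nat le_ma.
case: (altP andP) => [[/eqP-> /eqP->]|_] /=.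
  by rewrite (negPf nxy) /= mulr1 mulr0 subr0 shift.
rewrite mulr0 subr0; case: (altP andP) => [[/eqP-> /eqP->]|_] /=.
  by rewrite mulr1 shift // multC.
by rewrite mulr0 subr0.
Qed.

(** The Laplacian changes by [- k] times that of the single edge xy, which has rank one: it sends
    [s] to [- (s x - s y)] times [delta_val x y]. *)
Lemma lap_mul_change_edges G k s : x != y -> (0 <= k -> k <= (G x y)%:Z) ->
  lap_mul (change_edges G x y k) s =
    lap_mul G s + delta_val x y *~ (k * (s x - s y)).
Proof.
move=> nxy le_k; apply/ffunP => v; rewrite lap_mulE ffunE lap_mulE ffunMzE ffunE.
under eq_bigr do rewrite change_edgesE // !mulrBl.
have pick a b : \sum_w k * ((v == a) && (w == b))%:R * (s v - s w) =
                k * (v == a)%:R * (s a - s b).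
  rewrite (bigD1 b) //= eqxx andbT big1 ?addr0 => [|w /negPf->].
    by case: eqP => [->|] //; rewrite mulr0 !mul0r.
  by rewrite andbF mulr0 mul0r.
rewrite !sumrB !pick -addrA; congr (_ + _); rewrite mulrzz.
by ring.
Qed.

(** The preimage in [Div0 V] of the subgroup generated by the class of [delta x y], phrased on
    divisors so that different graphs can be compared. *)
Definition delta_principal G D :=
  exists m s, div0_val D = lap_mul G s + delta_val x y *~ m.

(** The same [s] serves both graphs; the multiple of [delta_val x y] by which the Laplacians differ
    is absorbed into [m]. *)
Lemma delta_principal_change_edges G k D :
    x != y -> (0 <= k -> k <= (G x y)%:Z) ->
  delta_principal (change_edges G x y k) D <-> delta_principal G D.
Proof.
move=> nxy le_k; split=> -[m [s Ds]].
  exists (k * (s x - s y) + m), s.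
  by rewrite Ds lap_mul_change_edges // mulrzDr addrA.
exists (m - k * (s x - s y)), s.
by rewrite Ds lap_mul_change_edges // mulrzBr -addrA subrKC.
Qed.

Lemma jac_classB G (cG : connected_graph G) D E :
  jac_class cG (D - E) = jac_class cG D - jac_class cG E.
Proof. exact: raddfB. Qed.

Lemma jac_classMz G (cG : connected_graph G) D m :
  jac_class cG (D *~ m) = jac_class cG D *~ m.
Proof. exact: raddfMz. Qed.

Lemma mem_cycle_delta G (cG : connected_graph G) D :
  (jac_class cG D \in <[jac_class cG (delta x y)]>)%g <-> delta_principal G D.
Proof.
have valE m : div0_val (D - delta x y *~ m) = div0_val D - delta_val x y *~ m.
  by rewrite [LHS](raddfB val) [X in _ - X](raddfMz val).
split=> [/cycleP[m]|[m [s Ds]]].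
  (* The group law is addition, so powers are multiples. [cycleP] yields only natural exponents; in
     the converse, negative multiples are reached through inverses. *)
  have -> : (jac_class cG (delta x y) ^+ m)%g = jac_class cG (delta x y) *~ m.
    by elim: m => // m IHm; rewrite expgS IHm -[RHS]pmulrn mulrS.
  rewrite -jac_classMz => /eqP; rewrite jac_classE inE => /asboolP[s].
  by rewrite valE => /eqP; rewrite subr_eq => /eqP Ds; exists m, s.
suff -> : jac_class cG D = jac_class cG (delta x y) *~ m.
  have mem n : jac_class cG (delta x y) *+ n \in <[jac_class cG (delta x y)]>%g.
    by elim: n => [|n IHn]; [exact: group1 | rewrite mulrS; exact: groupM (cycle_id _) _].
  by case: m {Ds} => n; [exact: mem | exact: groupVr (mem _)].
rewrite -jac_classMz; apply/eqP; rewrite jac_classE inE; apply/asboolP.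
by exists s; rewrite valE Ds addrK.
Qed.

End ChangeEdges.

(** Each class of [Jac cG] is lifted to a representative divisor and projected to [Jac cH]. This
    need not be a morphism, but differences can be compared on divisors, where the hypothesis
    applies. *)
Lemma leq_jac_index (V : finType) (x y : V) (G H : multigraph V)
    (cG : connected_graph G) (cH : connected_graph H) :
    (forall D, delta_principal x y H D -> delta_principal x y G D) ->
  (#|[set: Jac cG] : <[jac_class cG (delta x y)]>|%g
     <= #|[set: Jac cH] : <[jac_class cH (delta x y)]>|%g)%N.
Proof.
move=> HG.
apply: (@leq_index_preim _ _ _ _
  (fun c : Jac cG => jac_class cH (generic_quotient.repr c))) => a b.
have classK (c : Jac cG) : jac_class cG (generic_quotient.repr c) = c.
  exact: generic_quotient.reprK.
have -> : (a * b^-1 = jac_class cG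
    (generic_quotient.repr a - generic_quotient.repr b))%g.
  by rewrite jac_classB !classK.
have -> : (jac_class cH (generic_quotient.repr a) *
    (jac_class cH (generic_quotient.repr b))^-1 = jac_class cH
    (generic_quotient.repr a - generic_quotient.repr b))%g.
  by rewrite jac_classB.
by move/mem_cycle_delta/HG => /(mem_cycle_delta x y cG).
Qed.

Theorem theorem3p4 (V : finType) (G : multigraph V) (x y : V) (k : int)
    (neq_xy : x != y) (le_k : 0 <= k -> k <= (G x y)%:Z)
    (cG : connected_graph G) (cG1 : connected_graph (change_edges G x y k)) :
  (#|[set: Jac cG] : <[jac_class cG (delta x y)]>|%g
     %| gcdn #|Jac cG| #|Jac cG1|)%N
  /\
  (#|[set: Jac cG1] : <[jac_class cG1 (delta x y)]>|%g
     %| gcdn #|Jac cG| #|Jac cG1|)%N.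
Proof.
have eq_index : #|[set: Jac cG] : <[jac_class cG (delta x y)]>|%g
              = #|[set: Jac cG1] : <[jac_class cG1 (delta x y)]>|%g.
  (* The two inequalities use the two directions of [delta_principal_change_edges]. *)
  apply/eqP; rewrite eqn_leq; apply/andP.
  by split; apply: leq_jac_index => D /delta_principal_change_edges; apply.
have dvd_index H (cH : connected_graph H) :
    (#|[set: Jac cH] : <[jac_class cH (delta x y)]>|%g %| #|Jac cH|)%N.
  by rewrite -cardsT dvdn_indexg.
by split; rewrite dvdn_gcd; apply/andP; split; rewrite ?dvd_index //;
  [rewrite eq_index | rewrite -eq_index]; exact: dvd_index.
Qed.
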